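(* Let $r\ge s\ge 1$ be integers, let \[D:=\langle x,y\mid x^{2^r}=y^{2^s}=[x,y]^2=[x,x,y]=[y,x,y]=1\rangle,\] and let $\mathcal{F}$ be a fusion system on $D$. Then $\mathcal{F}$ is nilpotent or $s=1$ or $r=s$. If $r=s\ge 2$, then $\mathcal{F}$ is controlled by $D$.
   Context: Notation: $[x,y]:=xyx^{-1}y^{-1}$, $[x,x,y]:=[x,[x,y]]$ and $[y,x,y]:=[y,[x,y]]$. Fusion systems are understood to be saturated. A fusion system $\mathcal{F}$ on a finite $2$-group $D$ is nilpotent if $\mathcal{F}=\mathcal{F}_D(D)$, i.e. all morphisms of $\mathcal{F}$ are induced by conjugation with elements of $D$. $\mathcal{F}$ is controlled by $D$ if every morphism of $\mathcal{F}$ is a restriction of an element of $\operatorname{Aut}_{\mathcal{F}}(D)$. *)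

(* Defs.v *)
From HB Require Import structures.
Set Warnings "-notation-overridden".
From mathcomp Require Import all_boot all_fingroup all_solvable.

Set Implicit Arguments.
Unset Strict Implicit.
Unset Printing Implicit Defensive.

Local Open Scope group_scope.

(* MathComp's [~ x, y] is x^-1 * y^-1 * x * y; inside presentations, [x, y]
   denotes the other convention x * y * x^-1 * y^-1, i.e., [~ x^-1, y^-1].    *)
Notation "[ x , y ]" :=
  (Presentation.Comm (Presentation.Inv x) (Presentation.Inv y))
  (in custom group_presentation, x at level 100, y at level 100).

(* A homomorphism with domain P is represented by any function gT -> gT that
   agrees with it on P. Accordingly, the Hom-sets of a fusion system are
   stable under extensional equality on P (axiom fhom_ext), and the values of
   a representative outside P are irrelevant.                                 *)
Definition injhom (gT : finGroupType) (P Q : {group gT}) (f : gT -> gT) : Prop :=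
  [/\ {in P &, {morph f : u v / u * v}}, {in P &, injective f}
    & f @: P \subset Q].

Record fusion_system (gT : finGroupType) (S : {group gT}) := FusionSystem {
  fhom :> {group gT} -> {group gT} -> (gT -> gT) -> bool;
  fhom_ext : forall (P Q : {group gT}) f g,
    {in P, f =1 g} -> fhom P Q f -> fhom P Q g;
  fhom_sub : forall P Q f, fhom P Q f -> P \subset S /\ Q \subset S;
  fhom_inj : forall P Q f, fhom P Q f -> injhom P Q f;
  fhom_conj : forall (P Q : {group gT}) g,
    P \subset S -> Q \subset S -> g \in S -> P :^ g \subset Q ->
    fhom P Q (conjg^~ g);
  fhom_comp : forall P Q R f g,
    fhom P Q f -> fhom Q R g -> fhom P R (g \o f);
  (* f is an F-isomorphism onto R = f(P), followed by an inclusion *)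
  fhom_iso : forall (P Q R : {group gT}) f f',
    fhom P Q f -> f @: P = R -> {in P, cancel f f'} ->
    fhom P R f /\ fhom R P f'
}.

Section InnerFusion.

Variables (gT : finGroupType) (S : {group gT}).

Definition inner_hom (P Q : {group gT}) (f : gT -> gT) : bool :=
  [&& P \subset S, Q \subset S &
    [exists g in S, (P :^ g \subset Q) && [forall u in P, f u == u ^ g]]].

Lemma inner_homP (P Q : {group gT}) f :
  reflect [/\ P \subset S, Q \subset S &
    exists g, [/\ g \in S, P :^ g \subset Q & {in P, f =1 conjg^~ g}]]
    (inner_hom P Q f).
Proof.
apply: (iffP and3P) => [] [sPS sQS H]; split=> //.
  have /exists_inP[g Sg /andP[sPQ /forall_inP fE]] := H.
  by exists g; split=> // u Pu; apply/eqP/fE.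
have [g [Sg sPQ fE]] := H; apply/exists_inP; exists g => //.
by rewrite sPQ; apply/forall_inP=> u Pu; apply/eqP/fE.
Qed.

Lemma inner_ext (P Q : {group gT}) f g :
  {in P, f =1 g} -> inner_hom P Q f -> inner_hom P Q g.
Proof.
move=> fg /inner_homP[sPS sQS [h [Sh sPQ fE]]]; apply/inner_homP.
by split=> //; exists h; split=> // u Pu; rewrite -fg // fE.
Qed.

Lemma inner_sub P Q f : inner_hom P Q f -> P \subset S /\ Q \subset S.
Proof. by case/and3P. Qed.

Lemma inner_inj P Q f : inner_hom P Q f -> injhom P Q f.
Proof.
case/inner_homP=> sPS sQS [h [Sh sPQ fE]]; split.
- by move=> u v Pu Pv; rewrite !fE ?groupM // conjMg.
- by move=> u v Pu Pv; rewrite !fE //; apply: conjg_inj.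
apply/subsetP=> _ /imsetP[u Pu ->]; rewrite fE //.
by apply: (subsetP sPQ); rewrite memJ_conjg.
Qed.

Lemma inner_conj (P Q : {group gT}) g :
  P \subset S -> Q \subset S -> g \in S -> P :^ g \subset Q ->
  inner_hom P Q (conjg^~ g).
Proof. by move=> sPS sQS Sg sPQ; apply/inner_homP; split=> //; exists g. Qed.

Lemma inner_comp P Q R f g :
  inner_hom P Q f -> inner_hom Q R g -> inner_hom P R (g \o f).
Proof.
case/inner_homP=> sPS sQS [h [Sh sPQ fE]].
case/inner_homP=> _ sRS [k [Sk sQR gE]]; apply/inner_homP; split=> //.
exists (h * k); split; first exact: groupM.
  by rewrite conjsgM (subset_trans _ sQR) // conjSg.
move=> u Pu /=; rewrite fE // gE ?conjgM //.
by apply: (subsetP sPQ); rewrite memJ_conjg.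
Qed.

Lemma inner_iso (P Q R : {group gT}) f f' :
  inner_hom P Q f -> f @: P = R -> {in P, cancel f f'} ->
  inner_hom P R f /\ inner_hom R P f'.
Proof.
case/inner_homP=> sPS sQS [h [Sh sPQ fE]] fP fK.
have defR : R :=: P :^ h.
  by rewrite -fP; apply: eq_in_imset => u /fE.
have sRS : R \subset S by rewrite defR (subset_trans sPQ).
split; apply/inner_homP; split=> //.
  by exists h; split=> //; rewrite defR.
exists h^-1; split; rewrite ?groupV // defR ?conjsgK // => _ /imsetP[u Pu ->].
by rewrite conjgK -fE // fK.
Qed.

Definition inner_fusion : fusion_system S :=
  FusionSystem inner_ext inner_sub inner_inj inner_conj inner_comp inner_iso.

End InnerFusion.

Section FusionSystems.

Variables (gT : finGroupType) (S : {group gT}) (F : fusion_system S).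

Definition fconjugate (P Q : {group gT}) : Prop :=
  exists2 f, F P Q f & f @: P = Q.

Definition AutF (P : {group gT}) : {set {perm gT}} := [set a in Aut P | F P P a].

Lemma AutF_group_set (P : {group gT}) : P \subset S -> group_set (AutF P).
Proof.
move=> sPS; apply/group_setP; split.
  rewrite inE group1; apply: fhom_ext (fhom_conj F sPS sPS (group1 S) _).
    by move=> u Pu; rewrite /= perm1 conjg1.
  by rewrite conjsg1.
move=> a b /setIdP[Aa Fa] /setIdP[Ab Fb]; apply/setIdP; split; first exact: groupM.
apply: fhom_ext (fhom_comp Fa Fb).
by move=> u Pu; rewrite permM.
Qed.

Definition fully_normalized (P : {group gT}) : Prop :=
  forall Q : {group gT}, fconjugate P Q -> #|'N_S(Q)| <= #|'N_S(P)|.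

Definition fully_centralized (P : {group gT}) : Prop :=
  forall Q : {group gT}, fconjugate P Q -> #|'C_S(Q)| <= #|'C_S(P)|.

(* The subgroup usually written N_phi: all g in 'N_S(P) such that the
   automorphism phi o c_g o phi^-1 of phi(P) is induced by an element of
   'N_S(phi(P)). *)
Definition ext_dom (P : {group gT}) (phi : gT -> gT) : {set gT} :=
  [set g in 'N_S(P) | [exists h in 'N_S(phi @: P),
    [forall u in P, phi (u ^ g) == phi u ^ h]]].

Lemma ext_dom_group_set (P : {group gT}) phi : group_set (ext_dom P phi).
Proof.
apply/group_setP; split.
  rewrite inE group1; apply/exists_inP; exists 1; first exact: group1.
  by apply/forall_inP=> u _; rewrite !conjg1.
move=> g1 g2 /setIdP[Ng1 /exists_inP[h1 Nh1 /forall_inP E1]].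
case/setIdP=> Ng2 /exists_inP[h2 Nh2 /forall_inP E2].
apply/setIdP; split; first exact: groupM.
apply/exists_inP; exists (h1 * h2); first exact: groupM.
apply/forall_inP=> u Pu; rewrite !conjgM (eqP (E2 _ _)) ?(eqP (E1 _ _)) //.
by case/setIP: Ng1 => _ Ng1; rewrite memJ_norm.
Qed.

Canonical ext_dom_group P phi := Group (ext_dom_group_set P phi).

(* The saturation axioms of Broto, Levi and Oliver; S is meant to be a p-group.
   conj_aut P @* 'N_S(P) is the group Aut_S(P) of automorphisms of P induced
   by conjugation in S. *)
Definition saturated (p : nat) : Prop :=
  (forall P : {group gT}, P \subset S -> fully_normalized P ->
     fully_centralized P /\ p.-Sylow(AutF P) (conj_aut P @* 'N_S(P)))
  /\
  (forall (P Q : {group gT}) (phi : gT -> gT),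
     F P S phi -> phi @: P = Q -> fully_centralized Q ->
     exists psi : gT -> gT,
       F (ext_dom_group P phi) S psi /\ {in P, psi =1 phi}).

Definition fusion_nilpotent : Prop :=
  forall (P Q : {group gT}) (f : gT -> gT), F P Q f = inner_fusion S P Q f.

Definition fusion_controlled : Prop :=
  forall (P Q : {group gT}) (f : gT -> gT), F P Q f ->
  exists2 a : {perm gT}, a \in AutF S & {in P, f =1 a}.

End FusionSystems.

(* Main.v *)
Require Import Defs.
From mathcomp Require Import all_boot all_fingroup all_solvable.
From mathcomp Require Import zmodp.

(* Here 'Z(D) = 'Phi(D) has index 4 and D/D' is C_(2^r) x C_(2^s), so for
   s >= 2 every involution of D is central. By downward induction on |P|, every
   F-morphism P -> D extends to D. If 'C_D(P) is not contained in P, then any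
   morphism from P onto a fully centralized conjugate extends to the larger
   group P'C_D(P), and comparing P and its image with such a conjugate settles
   the claim. Otherwise P = D, or P is an abelian subgroup of index 2 and each
   element of Aut_D(P) is trivial both on the involutions of P and modulo them.
   This property survives transport along a morphism P -> Q, and any two
   automorphisms with it commute and square to 1; hence the transport of
   Aut_D(P) lies in the Sylow subgroup Aut_D(Q) and the morphism extends to
   'N_D(P) = D. So F is controlled by D.
   If moreover s < r, the elements of D of order at most 2^(r-1) modulo D' form
   a characteristic subgroup of index 2. An automorphism of odd prime order then
   fixes a point outside it and a point of it outside 'Phi(D), so it is trivial.
   Thus Aut(D) is a 2-group, Aut_F(D) is inner, and F is nilpotent. *)

Set Implicit Arguments.
Unset Strict Implicit.
Unset Printing Implicit Defensive.

Local Open Scope group_scope.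

(** * Images, automorphisms and conjugates inside a fusion system *)

Section FusionBasics.

Variables (gT : finGroupType) (D : {group gT}) (F : fusion_system D).
Implicit Types (P Q R : {group gT}) (f g : gT -> gT).

Lemma fhom_incl P Q : P \subset Q -> Q \subset D -> F P Q id.
Proof.
move=> sPQ sQD; apply: (@fhom_ext _ _ F _ _ (conjg^~ 1)).
  by move=> u _; rewrite conjg1.
by apply: fhom_conj; rewrite ?conjsg1 // (subset_trans sPQ).
Qed.

Lemma fhom_subl P Q R f : P \subset Q -> F Q R f -> F P R f.
Proof.
move=> sPQ Ff; have [sQD _] := fhom_sub Ff.
exact: (fhom_comp (fhom_incl sPQ sQD) Ff).
Qed.

Lemma fhom_subr P Q R f : Q \subset R -> R \subset D -> F P Q f -> F P R f.
Proof. by move=> sQR sRD Ff; apply: (fhom_comp Ff (fhom_incl sQR sRD)). Qed.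

Lemma fhom_im P Q f : F P Q f ->
  exists (R : {group gT}) f',
    [/\ f @: P = R, {in P, cancel f f'}, F P R f & F R P f'].
Proof.
move=> Ff; have [fM f_inj _] := fhom_inj Ff.
(* The default 1 is harmless: [fhom_iso] only asks that [f'] invert [f] on [P]. *)
pose f' v := odflt 1 [pick u in P | f u == v].
have fK : {in P, cancel f f'}.
  move=> u Pu; rewrite /f'; case: pickP => [v /andP[Pv /eqP/f_inj->] // |].
  by move/(_ u); rewrite Pu eqxx.
have gR : group_set (f @: P).
  apply/group_setP; split.
    apply/imsetP; exists 1; rewrite ?group1 //.
    by apply: (mulgI (f 1)); rewrite mulg1 -fM ?group1 // mulg1.
  move=> _ _ /imsetP[u Pu ->] /imsetP[v Pv ->].
  by rewrite -fM // imset_f ?groupM.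
exists (Group gR), f'.
by have [] := fhom_iso (R := Group gR) Ff (erefl _) fK.
Qed.

Lemma fhom_AutF P f : F P P f -> exists2 a, a \in AutF F P & {in P, f =1 a}.
Proof.
move=> Ff; have [fM f_inj sfP] := fhom_inj Ff.
exists (perm_in f_inj sfP); last by move=> u Pu; rewrite perm_inE.
rewrite inE; apply/andP; split.
  rewrite inE perm_in_on; apply/morphicP=> u v Pu Pv.
  by rewrite !perm_inE ?groupM ?fM.
by apply: fhom_ext Ff => u Pu; rewrite perm_inE.
Qed.

Lemma AutF_inv P a : P \subset D -> a \in AutF F P -> a^-1 \in AutF F P.
Proof.
by move=> sPD Aa; rewrite -(groupV (Group (AutF_group_set F sPD))) in Aa.
Qed.

Lemma AutF_mul P a b : P \subset D -> a \in AutF F P -> b \in AutF F P ->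
  a * b \in AutF F P.
Proof.
by move=> sPD; apply: (@groupM _ (Group (AutF_group_set F sPD))).
Qed.

(** Ranging over finite functions makes conjugacy a boolean predicate, so that one can maximize over
    conjugates; [fhom_ext] justifies the change of representative. *)
Lemma fconjugateP P Q :
  reflect (fconjugate F P Q)
    [exists f : {ffun gT -> gT}, F P Q f && (f @: P == Q)].
Proof.
apply: (iffP existsP) => [[f /andP[Ff /eqP fP]] | [f Ff fP]]; first by exists f.
exists (finfun f); apply/andP; split.
  by apply: fhom_ext Ff => u _; rewrite ffunE.
by rewrite -fP; apply/eqP/eq_in_imset => u _; rewrite ffunE.
Qed.

Lemma fconjugate_trans P Q R :
  fconjugate F P Q -> fconjugate F Q R -> fconjugate F P R.
Proof.
move=> [f Ff fP] [g Fg gQ]; exists (g \o f); first exact: fhom_comp Ff Fg.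
by rewrite imset_comp fP gQ.
Qed.

Lemma ex_fully_centralized P : P \subset D ->
  exists2 Q, fconjugate F P Q & fully_centralized F Q.
Proof.
move=> sPD.
have FPP : fconjugate F P P.
  by exists id; rewrite ?imset_id // fhom_incl.
pose conjP Q := [exists f : {ffun gT -> gT}, F P Q f && (f @: P == Q)].
have [Q /fconjugateP FPQ maxQ] :=
  @arg_maxnP _ P conjP (fun Q => #|'C_D(Q)|) (introT (fconjugateP P P) FPP).
by exists Q => // R FQR; apply: maxQ; apply/fconjugateP/(fconjugate_trans FPQ).
Qed.

Lemma fconjugate_card P Q : fconjugate F P Q -> #|Q| = #|P|.
Proof.
by case=> f Ff fP; have [_ f_inj _] := fhom_inj Ff; rewrite -fP card_in_imset.
Qed.

End FusionBasics.

(** * Extending morphisms to automorphisms of [D] *)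

Section Control.

Variables (gT : finGroupType) (D : {group gT}) (F : fusion_system D).
Implicit Types (P Q R : {group gT}) (f g : gT -> gT).

Hypothesis satF : saturated F 2.
Hypothesis involZ : {in D, forall u, u ^+ 2 = 1 -> u \in 'Z(D)}.
Hypothesis comm2 : {in D &, forall u v, [~ u, v] ^+ 2 = 1}.

(** Index 2 makes [Q] normal, hence fully normalized; saturation then makes it fully centralized,
    with Aut_D(Q) Sylow in Aut_F(Q). The extension axiom reaches all of [D] once f c_g f^-1 lies in
    Aut_D(Q) for every [g] in [D]. *)
Lemma extends_index2 P Q f :
    F P Q f -> f @: P = Q -> abelian P -> #|D : P| = 2 ->
  exists2 a, a \in AutF F D & {in P, f =1 a}.
Proof.
move=> Ff fP abP iP.
have [sPD sQD] := fhom_sub Ff.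
have [R [f' [fR fK FPR Ff']]] := fhom_im Ff.
have defR : R = Q by apply: val_inj; rewrite /= -fR.
move: FPR Ff'; rewrite {}defR {R fR} => _ Ff'.
have FQ R : fconjugate F Q R -> #|D : R| = 2.
  move=> FQR; have FPR : fconjugate F P R.
    by apply: fconjugate_trans FQR; exists f.
  have sRD : R \subset D by case: FPR => h /fhom_sub[].
  by rewrite -divgS // (fconjugate_card FPR) divgS.
have nQD : Q <| D.
  apply: index2_normal => //; apply: FQ; exists id; rewrite ?imset_id //.
  exact: fhom_incl.
have nPD : P <| D by apply: index2_normal.
have fnQ : fully_normalized F Q.
  move=> R _; rewrite subset_leq_card // (setIidPl (normal_norm nQD)).
  exact: subsetIl.
have [fcQ sylT] := satF.1 Q sQD fnQ.
rewrite (setIidPl (normal_norm nQD)) in sylT.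
set T := conj_aut Q @* D in sylT.
have [fM f_inj sfP] := fhom_inj Ff.
have [f'M _ sf'Q] := fhom_inj Ff'.
have f'K : {in Q, cancel f' f}.
  by move=> v; rewrite -fP => /imsetP[u Pu ->]; rewrite fK.
have Pf' v : v \in Q -> f' v \in P.
  by move=> Qv; apply: (subsetP sf'Q); rewrite imset_f.
have Qf u : u \in P -> f u \in Q.
  by move=> Pu; apply: (subsetP sfP); rewrite imset_f.
(* For g in D, a := f o c_g o f^-1 multiplies each v by a central involution
   (or 1) w v, and so does every element of T. *)
suffices sDN : D \subset ext_dom D P f.
  have [psi [Fpsi psiE]] := satF.2 P Q f (fhom_subr sQD (subxx _) Ff) fP fcQ.
  have [a Aa aE] := fhom_AutF (fhom_subl (P := D) sDN Fpsi).
  by exists a => // u Pu; rewrite -aE ?psiE // (subsetP sPD).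
apply/subsetP=> g Dg.
have Pg u : u \in P -> u ^ g \in P.
  by move=> Pu; rewrite memJ_norm // (subsetP (normal_norm nPD)).
have [a Aa aE] :
    exists2 a, a \in AutF F Q & {in Q, (fun v => f (f' v ^ g)) =1 a}.
  apply: fhom_AutF.
  have Fg : F P P (conjg^~ g).
    by apply: fhom_conj; rewrite // (normsP (normal_norm nPD)).
  exact: (fhom_comp (fhom_comp Ff' Fg) Ff).
pose w v := f [~ f' v, g].
have sub_u u : u \in P -> [~ u, g] \in P.
  by move=> Pu; rewrite commgEl groupM ?groupV ?Pg.
have aw v : v \in Q -> a v = v * w v.
  move=> Qv; rewrite -aE // /w -{2}(f'K v Qv) -fM ?Pf' ?sub_u ?Pf' //.
  by rewrite commgEl mulKVg.
have Qw v : v \in Q -> w v \in Q by move=> Qv; rewrite Qf ?sub_u ?Pf'.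
have f1 : f 1 = 1 by apply: (mulgI (f 1)); rewrite mulg1 -fM ?group1 // mulg1.
have f'1 : f' 1 = 1 by rewrite -f1 fK.
have w2 v : v \in Q -> w v ^+ 2 = 1.
  move=> Qv; have Pv := Pf' v Qv; rewrite expgS expg1 -fM ?sub_u //.
  by rewrite -[_ * _]/(_ ^+ 2) comm2 // (subsetP sPD).
have wZ v : v \in Q -> w v \in 'Z(D).
  by move=> Qv; rewrite involZ ?w2 // (subsetP sQD) ?Qw.
have a_fix v : v \in Q -> v ^+ 2 = 1 -> a v = v.
  move=> Qv v2; rewrite -aE // (_ : f' v ^ g = f' v) ?f'K //.
  have /centerP[_ cv] : f' v \in 'Z(D).
    apply: involZ; first by rewrite (subsetP sPD) ?Pf'.
    by rewrite expgS expg1 -f'M // -[v * v]/(v ^+ 2) v2.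
  by apply/conjg_fixP/commgP; apply: cv.
have aM : {in Q &, {morph a : u v / u * v}}.
  by case/setIdP: Aa; rewrite inE => /andP[_ /morphicP].
(* Since [a] fixes [w v], applying [a] twice multiplies [v] by the square of [w v], which is 1. *)
have a2 : a ^+ 2 = 1.
  case/setIdP: Aa => Aa _; apply: (eq_Aut (groupX 2 Aa) (group1 _)) => v Qv.
  rewrite expgS expg1 permM perm1 (aw v) // aM ?Qw // aw // a_fix ?Qw ?w2 //.
  by rewrite -mulgA -[_ * _ in X in _ * X]/(_ ^+ 2) w2 // mulg1.
(* In either order, [a] and conjugation by [h] multiply [v] by [w v] and [[~ v, h]]: [a] fixes
   [[~ v, h]], whose square is 1, and [h] fixes the central element [w v]. *)
have cTa : a \in 'C(T).
  apply/centP => _ /morphimP[h Nh Dh ->].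
  have Ah : conj_aut Q h \in Aut Q by apply: Aut_aut.
  case/setIdP: (Aa) => Aa' _.
  apply: (eq_Aut (groupM Aa' Ah) (groupM Ah Aa')) => v Qv.
  have nQh : h \in 'N(Q) by [].
  have Qvh : v ^ h \in Q by rewrite memJ_norm.
  have Dv : v \in D by rewrite (subsetP sQD).
  rewrite !permM (norm_conj_autE nQh Qv) norm_conj_autE //; last first.
    by rewrite aw ?groupM ?Qw.
  have -> : v ^ h = v * [~ v, h] by rewrite commgEl mulKVg.
  have Qvh' : [~ v, h] \in Q by rewrite commgEl groupM ?groupV.
  rewrite aM // [a [~ _, _]]a_fix ?comm2 // aw // conjMg.
  have /centerP[_ cw] := wZ v Qv.
  have -> : w v ^ h = w v by apply/conjg_fixP/commgP; apply: cw.
  have cwv : w v * [~ v, h] = [~ v, h] * w v by apply: cw; rewrite groupR.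
  by rewrite -[RHS]mulgA cwv mulgA commgEl mulKVg.
(* As [a] centralizes [T] and squares to 1, it generates with [T] a 2-subgroup of Aut_F(Q), which
   cannot exceed the Sylow subgroup [T]. *)
have Ta : a \in T.
  have [sTA pT _] := and3P sylT.
  have pTa : 2.-group (T <*> <[a]>).
    rewrite joingC cent_joinEl ?cycle_subG // pgroupM pT andbT.
    rewrite /pgroup -orderE; apply: (@pnat_dvd _ 2); last by [].
    by rewrite order_dvdn a2.
  have sTaA : T <*> <[a]> \subset Group (AutF_group_set F sQD).
    by rewrite join_subG cycle_subG sTA.
  have defT := sub_pHall (H := (conj_aut Q @* D)%G) (K := (T <*> <[a]>)%G)
    (G := Group (AutF_group_set F sQD)) sylT pTa (joing_subl _ _) sTaA.
  by rewrite -cycle_subG /T -defT joing_subr.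
case/morphimP: Ta => h Nh Dh ah.
rewrite inE inE Dg (subsetP (normal_norm nPD)) //=; apply/exists_inP.
exists h; first by rewrite fP inE Dh.
apply/forall_inP => u Pu; apply/eqP.
by rewrite -(norm_conj_autE Nh (Qf u Pu)) -ah -aE ?fK ?Qf.
Qed.

Hypothesis iZ : #|D : 'Z(D)| = 4.

(** If [P] contained its centralizer, it would contain ['Z(D)], so its index would be 2 or 4. Index
    2 makes P/Z(D) cyclic, so [P] is abelian; index 4 makes [P] equal to ['Z(D)], whose centralizer
    is all of [D]. *)
Lemma cent_not_sub P : P \proper D ->
  ~~ (abelian P && (#|D : P| == 2)) -> ~~ ('C_D(P) \subset P).
Proof.
move=> ltPD; apply: contra => sCP; have sPD := proper_sub ltPD.
have sZP : 'Z(D) \subset P by apply: subset_trans sCP; rewrite setIS ?centS.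
have := Lagrange_index sPD sZP; rewrite iZ => oDP.
have iP1 : #|D : P| != 1%N.
  by rewrite indexg_eq1; apply: contraL ltPD => sDP; rewrite properE sDP andbF.
have : #|D : P| \in divisors 4 by rewrite -dvdn_divisors // -oDP dvdn_mulr.
rewrite !inE (negPf iP1) /= => /orP[] /eqP iP.
  rewrite iP eqxx andbT; apply: (@cyclic_factor_abelian _ 'Z(D) P).
    by rewrite subsetI sZP (subset_trans (subsetIr _ _)) ?centS.
  rewrite prime_cyclic // card_quotient; last first.
    by rewrite (subset_trans sPD) ?gFnorm.
  by move: oDP; rewrite iP => /eqP; rewrite (eqn_pmul2l (n2 := 2)) // => /eqP->.
case/negP: iP1; rewrite indexg_eq1; apply: subset_trans sCP.
rewrite subsetI subxx; apply: subset_trans (centS (_ : P \subset 'Z(D))).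
  by rewrite centsC subsetIr.
by rewrite -indexg_eq1 -(eqn_pmul2l (m := 4)) // -{1}iP oDP.
Qed.

(** The image [Q] of [f] need not be fully centralized, so the extension axiom may not apply to [f]
    itself. It does apply to [h] and [h \o f], where [h] maps [Q] onto a fully centralized [R];
    induction extends both to [D], and their quotient extends [f]. *)
Lemma extends_to_AutF P f :
  F P D f -> exists2 a, a \in AutF F D & {in P, f =1 a}.
Proof.
have [n] := ubnP (#|D| - #|P|); elim: n => // n IHn in P f * => le_n Ff.
have [sPD _] := fhom_sub Ff.
have [eqPD | ltPD] := eqVproper sPD.
  have {}eqPD : P = D by apply: val_inj.
  by move: Ff; rewrite eqPD; apply: fhom_AutF.
have [Q [_ [fP _ FPQ _]]] := fhom_im Ff.
have [_ sQD] := fhom_sub FPQ.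
have oQ : #|Q| = #|P| by apply: (@fconjugate_card _ _ F); exists f.
have iQ : #|D : Q| = #|D : P| by rewrite -!divgS // oQ.
have [/andP[abP /eqP iP] | notP] := boolP (abelian P && (#|D : P| == 2)).
  exact: extends_index2 FPQ fP abP iP.
have notQ : ~~ (abelian Q && (#|D : Q| == 2)).
  rewrite iQ; apply: contra notP => /andP[abQ ->]; rewrite andbT.
  have [fM f_inj sfP] := fhom_inj FPQ.
  apply/centsP=> u Pu v Pv; apply: f_inj; rewrite ?groupM // !fM //.
  by apply: (centsP abQ); rewrite (subsetP sfP) ?imset_f.
have ext (P1 R : {group gT}) h :
    #|P1| = #|P| -> ~~ (abelian P1 && (#|D : P1| == 2)) ->
    F P1 D h -> h @: P1 = R -> fully_centralized F R ->
  exists2 a, a \in AutF F D & {in P1, h =1 a}.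
- move=> oP1 notP1 Fh hP1 fcR; have [sP1D _] := fhom_sub Fh.
  have [psi [Fpsi psiE]] := satF.2 P1 R h Fh hP1 fcR.
  have ltP1D : P1 \proper D.
    rewrite properE sP1D; apply: contraL ltPD => /subset_leq_card.
    by rewrite oP1 properEcard ltnNge => ->; rewrite andbF.
  (* Conjugation by [g] in [P1] is carried by [h] to conjugation by [h g]. *)
  have sP1N : P1 \subset ext_dom D P1 h.
    apply/subsetP=> g P1g; have Dg := subsetP sP1D g P1g.
    apply/setIdP; split; first by rewrite inE Dg (subsetP (normG P1)).
    apply/exists_inP; exists (h g).
      rewrite hP1 inE; have [_ sRD] : F P1 R h /\ R \subset D.
        have [R' [h' [hR' _ FR' _]]] := fhom_im Fh.
        have -> : R = R' by apply: val_inj; rewrite /= -hP1.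
        by split=> //; case: (fhom_sub FR').
      have Rg : h g \in R by rewrite -hP1 imset_f.
      by rewrite (subsetP sRD) // (subsetP (normG R)).
    apply/forall_inP=> u P1u; apply/eqP; have [hM h_inj _] := fhom_inj Fh.
    by apply: (mulgI (h g)); rewrite -hM ?groupJ // -conjgC hM // -conjgC.
  (* Centralizing elements induce the identity on [P1], so 1 is a witness. By [cent_not_sub] the
     extension then has a strictly larger domain. *)
  have sCN : 'C_D(P1) \subset ext_dom D P1 h.
    apply/subsetP=> g /setIP[Dg cg].
    apply/setIdP; split; first by rewrite inE Dg (subsetP (cent_sub P1)).
    apply/exists_inP; exists 1; first exact: group1.
    apply/forall_inP=> u P1u; rewrite conjg1 (_ : u ^ g = u) //.
    by apply/conjg_fixP/commgP/commute_sym/(centP cg).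
  have ltP1N : P1 \proper ext_dom D P1 h.
    rewrite properE sP1N; apply: contra (cent_not_sub ltP1D notP1).
    exact: subset_trans.
  have sND : ext_dom D P1 h \subset D by case: (fhom_sub Fpsi).
  have [|a Aa aE] := IHn _ _ _ Fpsi.
    rewrite -ltnS; apply: leq_trans le_n; rewrite ltnS ltn_sub2l //.
      by rewrite -oP1 proper_card.
    by rewrite -oP1 proper_card.
  by exists a => // u P1u; rewrite -aE ?psiE // (subsetP sP1N).
have [R [h Fh hQ] fcR] := ex_fully_centralized F sQD.
have sRD := (fhom_sub Fh).2.
have FhD := fhom_subr sRD (subxx D) Fh.
have [b Ab bE] := ext Q R h oQ notQ FhD hQ fcR.
have hfR : (h \o f) @: P = R by rewrite imset_comp fP.
have [a Aa aE] := ext P R (h \o f) (erefl _) notP (fhom_comp FPQ FhD) hfR fcR.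
(* Permutation products apply the left factor first: [a] sends [u] to [h (f u)], which is [b (f u)],
   and [b^-1] returns [f u]. *)
exists (a * b^-1); first by rewrite AutF_mul ?AutF_inv.
move=> u Pu; rewrite permM -aE //= bE ?permK //.
by rewrite -[_ \in _]/(_ \in gval Q) -fP imset_f.
Qed.

End Control.

(** * Nilpotency, and a criterion for the automorphism group to be a 2-group *)

Section Nilpotency.

Variables (gT : finGroupType) (D : {group gT}) (F : fusion_system D).
Implicit Types (P Q : {group gT}).

(** [D] is fully normalized in itself, so Aut_D(D) is Sylow in the p-group Aut_F(D) and equals it.
    Every morphism thus extends to an inner automorphism. *)
Lemma fusion_nilpotent_pAut p :
    saturated F p -> p.-group (AutF F D) ->
    (forall P f, F P D f -> exists2 a, a \in AutF F D & {in P, f =1 a}) ->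
  fusion_nilpotent F.
Proof.
move=> [satF _] pA extF P Q f.
have fnD : fully_normalized F D.
  by move=> R _; rewrite subset_leq_card // (setIidPl (normG D)) subsetIl.
have [_ sylT] := satF D (subxx _) fnD.
have defA : AutF F D = conj_aut D @* 'N_D(D).
  pose A := Group (AutF_group_set F (subxx D)).
  have /and3P[sTA pT _] := sylT.
  pose T := (conj_aut D @* 'N_D(D))%G.
  exact: (sub_pHall (G := A) (H := T) (K := A) sylT pA sTA (subxx _)).
apply/idP/inner_homP => [Ff | [sPD sQD [g [Dg sPQ fE]]]]; last first.
  by apply: fhom_ext (fhom_conj F sPD sQD Dg sPQ) => u Pu; rewrite fE.
have [sPD sQD] := fhom_sub Ff; split=> //.
have [a Aa aE] := extF P f (fhom_subr sQD (subxx _) Ff).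
move: Aa; rewrite defA => /morphimP[g Ng /setIP[Dg _] ag].
have fE : {in P, f =1 conjg^~ g}.
  by move=> u Pu; rewrite aE // ag conj_autE // (subsetP sPD).
exists g; split=> //; have [_ _] := fhom_inj Ff; apply: subset_trans.
by apply/subsetP=> _ /imsetP[u Pu ->]; rewrite -fE // imset_f.
Qed.

(** For a p-group acting on a set, the number of fixed points is congruent to the size of the set
    modulo p. *)
Lemma perm_fixpoint (T : finType) (a : {perm T}) (S : {set T}) (p : nat) :
  p.-group <[a]> -> a @: S \subset S -> ~~ (p %| #|S|) ->
  exists2 u, u \in S & a u = u.
Proof.
move=> pa sSa p'S.
have [/exists_inP[u Su /eqP]|no_fix] := boolP [exists u in S, a u == u].
  by exists u.
case/negP: p'S.
have aS : [acts <[a]>, on S | 'P].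
  rewrite cycle_subG !inE; apply/subsetP=> u Su.
  by rewrite inE /= /aperm (subsetP sSa) ?imset_f.
have := pgroup_fix_mod pa aS; rewrite (_ : 'Fix_(S | 'P)(<[a]>) = set0); last first.
  apply/setP=> u; rewrite in_setI in_set0; apply/andP=> -[Su /afixP fixu].
  case/negP: no_fix; apply/exists_inP; exists u => //.
  by apply/eqP/(fixu a (cycle_id a)).
by rewrite cards0 /dvdn => ->; rewrite mod0n.
Qed.

Lemma joing_cycle_index_prime (G H : {group gT}) u :
  H \subset G -> prime #|G : H| -> u \in G -> u \notin H -> H <*> <[u]> = G.
Proof.
move=> sHG prG Gu H'u; have maxH := p_index_maximal sHG prG.
have sJG : H <*> <[u]> \subset G by rewrite join_subG sHG cycle_subG.
have /maxgroupP[_ maxH'] := maxH.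
case: (eqVproper sJG) => // ltJ; case/negP: H'u.
rewrite -cycle_subG -(maxH' (H <*> <[u]>)%G ltJ (joing_subl _ _)).
exact: joing_subr.
Qed.

(** An automorphism of odd prime order preserves M minus Phi(G) and G minus M. Both have 2-power
    size, so each contains a fixed point; the two points generate [G] modulo ['Phi(G)], hence
    generate [G]. *)
Lemma Aut_2group (G M : {group gT}) :
    2.-group G -> #|G : 'Phi(G)| = 4 -> 'Phi(G) \proper M -> M \proper G ->
  M \char G -> 2.-group (Aut G).
Proof.
move=> pG iPhi ltPM ltMG /andP[sMG /forall_inP aM].
have [sPM sPG] := (proper_sub ltPM, Phi_sub G).
(* Both indices exceed 1 and their product is 4. *)
have [iMP iGM] : #|M : 'Phi(G)| = 2 /\ #|G : M| = 2.
  have := Lagrange_index sMG sPM; rewrite iPhi.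
  have : #|G : M| > 1 by rewrite indexg_gt1; case/andP: ltMG.
  have : #|M : 'Phi(G)| > 1 by rewrite indexg_gt1; case/andP: ltPM.
  by case: #|M : _| => [|[|[|[|[|m]]]]] //; case: #|G : _| => [|[|[|[|[|n]]]]].
apply/pgroupP=> q pr_q /(Cauchy pr_q)[a Aa oa]; rewrite inE /=.
apply/negPn/negP=> q'2; have qa : q.-group <[a]> by rewrite /pgroup -orderE oa pnat_id.
have q'card (H : {group gT}) : H \subset G -> ~~ (q %| #|H|).
  move=> sHG; apply: contra q'2 => qH.
  by have /pgroupP/(_ q pr_q qH) := pgroupS sHG pG.
have im_diff (K H : {group gT}) :
  a @: K \subset K -> a @: H \subset H -> a @: (K :\: H) \subset K :\: H.
  move=> sK sH; apply/subsetP=> _ /imsetP[u /setDP[Ku H'u] ->].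
  rewrite inE (subsetP sK) ?imset_f // andbT; apply: contra H'u.
  have {}sH : a @: H = H.
    by apply/eqP; rewrite eqEcard sH (card_imset _ (@perm_inj _ a)) /=.
  by rewrite -{1}sH (mem_imset _ _ (@perm_inj _ a)).
have aP : a @: 'Phi(G) \subset 'Phi(G).
  by have /andP[_ /forall_inP/(_ a Aa)] := Phi_char G.
have aG : a @: G \subset G.
  by apply/subsetP=> _ /imsetP[u Gu ->]; rewrite Aut_closed.
have oDiff (K H : {group gT}) : H \subset K -> #|K : H| = 2 -> #|K :\: H| = #|H|.
  by move=> sHK iH; rewrite cardsDS // -(Lagrange sHK) iH muln2 -addnn addnK.
have [u /setDP[Mu P'u] au] : exists2 u, u \in M :\: 'Phi(G) & a u = u.
  by apply: perm_fixpoint qa _ _; rewrite ?im_diff ?aM // oDiff ?q'card.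
have [v /setDP[Gv M'v] av] : exists2 v, v \in G :\: M & a v = v.
  by apply: perm_fixpoint qa _ _; rewrite ?im_diff ?aM // oDiff ?q'card.
have defM : 'Phi(G) <*> <[u]> = M by apply: joing_cycle_index_prime; rewrite ?iMP.
have defG : M <*> <[v]> = G by apply: joing_cycle_index_prime; rewrite ?iGM.
have genG : <[u]> <*> <[v]> = G.
  by rewrite -[LHS]genGid; apply: Phi_nongen; rewrite joingA defM.
have fix_group : group_set [set w in G | a w == w].
  have aMor : {in G &, {morph a : u v / u * v}}.
    by move: Aa; rewrite inE => /andP[_ /morphicP].
  apply/group_setP; split.
    rewrite inE group1 /=; apply/eqP/(mulgI (a 1)).
    by rewrite mulg1 -aMor ?mulg1.
  move=> w1 w2 /setIdP[G1 /eqP a1] /setIdP[G2 /eqP a2].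
  by rewrite inE groupM //= aMor // a1 a2.
have sGfix : G \subset Group fix_group.
  suffices: <[u]> <*> <[v]> \subset Group fix_group by rewrite genG.
  rewrite join_subG !cycle_subG !inE au av !eqxx Gv.
  by rewrite (subsetP sMG).
have a1 : a = 1.
  apply: (eq_Aut Aa (group1 _)) => w Gw; rewrite perm1.
  by have /setIdP[_ /eqP] := subsetP sGfix w Gw.
by have := prime_gt1 pr_q; rewrite -oa a1 order1.
Qed.

End Nilpotency.

Lemma card_joing_cycles (gT : finGroupType) (x y : gT) m n :
    commute x y -> x ^+ m = 1 -> y ^+ n = 1 -> 0 < m -> 0 < n ->
  #|<[x]> <*> <[y]>| <= m * n.
Proof.
move=> cxy xm yn m_gt0 n_gt0.
have -> : <[x]> <*> <[y]> = <[x]> * <[y]>.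
  rewrite cent_joinEr // cycle_subG; apply/centP=> _ /cycleP[i ->].
  exact/commuteX/commute_sym.
have : #|<[x]> * <[y]>| <= #|<[x]>| * #|<[y]>|.
  by rewrite mul_cardG leq_pmulr ?cardG_gt0.
by move=> /leq_trans-> //; rewrite leq_mul // dvdn_leq // order_dvdn ?xm ?yn.
Qed.

(** * What the presentation gives: generators, abelianization, noncommutativity *)

Section MinNonAbelian.

Variables (gT : finGroupType) (r s : nat) (D : {group gT}).
Hypothesis r_gt0 : 0 < r.
Hypothesis s_gt0 : 0 < s.
Hypothesis presD :
  D \isog Grp (x : y : x ^+ (2 ^ r)%N, y ^+ (2 ^ s)%N, [x, y] ^+ 2,
                       [x, [x, y]], [y, [x, y]]).

Lemma pres_gens : exists x y : gT,
  [/\ <[x]> <*> <[y]> = D, x ^+ (2 ^ r) = 1, y ^+ (2 ^ s) = 1,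
      D^`(1) \subset 'Z(D) & {in D^`(1), forall z, z ^+ 2 = 1}].
Proof.
have /existsP[[x y] /=] := isoGrp_hom presD.
rewrite !xpair_eqE => /and5P[/eqP defD /eqP xr /eqP ys /eqP z2].
move=> /andP[/eqP xz /eqP yz].
exists x, y.
have defD' : <[x^-1]> <*> <[y^-1]> = D by rewrite !cycleV.
have cz : [~ x^-1, y^-1] \in 'C(D).
  rewrite -defD' -sub_cent1 join_subG !cycle_subG.
  have cV u v : [~ u, v^-1] = 1 -> u \in 'C[v].
    by move/eqP/commgP/commuteV; rewrite invgK => cuv; apply/cent1P/commute_sym.
  by rewrite !cV.
have Dz : [~ x^-1, y^-1] \in D.
  by rewrite groupR // -defD' -cycle_subG ?joing_subl ?joing_subr.
have derD : D^`(1) = <[[~ x^-1, y^-1]]>.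
  by have := @der1_joing_cycles _ x^-1 y^-1; rewrite /= defD' => ->.
split=> //; first by rewrite derD cycle_subG inE Dz.
move=> z; rewrite derD => /cycleP[i ->].
by rewrite -expgM mulnC expgM z2 expg1n.
Qed.

Lemma card_der1_quotient : 2 ^ (r + s) <= #|D / D^`(1)|.
Proof.
pose A := [set: ('Z_(2 ^ r) * 'Z_(2 ^ s))%type].
have oA : #|A| = (2 ^ (r + s))%N.
  (* Positivity of [r] and [s] matters, because ['Z_1] has two elements. *)
  by rewrite cardsT card_prod !card_ord !Zp_cast ?expnD // -{1}(expn0 2) ltn_exp2l.
have abA : abelian A.
  by apply/centsP=> u _ v _; congr (_, _); apply: Zp_mulgC.
have homA : A \homg D.
  have expA (u : 'Z_(2 ^ r)) (v : 'Z_(2 ^ s)) n : (u, v) ^+ n = (u ^+ n, v ^+ n).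
    by elim: n => // n IHn; rewrite !expgS IHn.
  have Zp1X m : (0 < m)%N -> (Zp1 : 'Z_(2 ^ m)) ^+ (2 ^ m) = 1.
    move=> m_gt0; apply/eqP.
    by rewrite -order_dvdn order_Zp1 Zp_cast // -{1}(expn0 2) ltn_exp2l.
  have cA (u v : ('Z_(2 ^ r) * 'Z_(2 ^ s))%type) : [~ u, v] = 1.
    by apply/eqP/commgP/(centsP abA); rewrite inE.
  rewrite presD; apply/existsP; exists ((Zp1, 1), (1, Zp1)).
  rewrite /= !cA !expA !Zp1X // !expg1n; apply/eqP; congr (_, _).
  apply/eqP; rewrite eqEsubset subsetT; apply/subsetP=> -[u v] _.
  have -> : (u, v) = (Zp1, 1) ^+ u * (1, Zp1) ^+ v.
    rewrite !expA !expg1n !Zp1_expgz; congr (_, _); last by rewrite mul1g.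
    by rewrite mulg1.
  by rewrite groupM // groupX // -cycle_subG ?joing_subl ?joing_subr.
have /homgP[f fD] := homA.
have sDf : D^`(1) \subset 'ker f.
  rewrite ker_trivg_morphim der_sub morphim_der // fD subG1.
  exact/eqP/commG1P.
rewrite -oA -fD card_morphim setIid card_quotient ?der_norm //.
by rewrite dvdn_leq ?indexg_gt0 // indexgS.
Qed.

Lemma pres_nonabelian : ~~ abelian D.
Proof.
(* The dihedral group of order 8 satisfies the relations, as r, s >= 1. *)
have hom8 : 'D_(4.*2) \homg D.
  rewrite presD.
  have /existsP[[x y] /=] := isoGrp_hom (Grp'_dihedral (q := 4) isT).
  rewrite !xpair_eqE => /and4P[/eqP defG /eqP x2 /eqP y2 /eqP xy4].
  apply/existsP; exists (x, y); rewrite /= !xpair_eqE defG eqxx /=.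
  have Vx : x^-1 = x by apply: (mulgI x); rewrite mulgV.
  have Vy : y^-1 = y by apply: (mulgI y); rewrite mulgV.
  (* For involutions [x] and [y] the commutator is the square of [x * y]. Each of them inverts
     [x * y], so it commutes with this square, which is its own inverse. *)
  have z2 : [~ x^-1, y^-1] = (x * y) ^+ 2.
    by rewrite commgEl conjgE !invgK Vx Vy expgS expg1 !mulgA.
  have Vxy : ((x * y) ^+ 2)^-1 = (x * y) ^+ 2.
    by apply: (mulgI ((x * y) ^+ 2)); rewrite mulgV -expgD.
  have Vxy' : (x * y) ^+ 2 = y * x * (y * x).
    by rewrite -Vxy expgS expg1 !invMg Vx Vy.
  have cx : commute x ((x * y) ^+ 2).
    rewrite /commute {2}Vxy' expgS expg1 -!mulgA.
    by rewrite -{1}Vx mulKg -{4}Vx mulgV mulg1.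
  have cy : commute y ((x * y) ^+ 2).
    rewrite /commute {1}Vxy' expgS expg1 -!mulgA.
    by rewrite -{1}Vy mulKg -{4}Vy mulgV mulg1.
  have pow2 m u : (0 < m)%N -> u ^+ 2 = 1 -> u ^+ (2 ^ m) = 1 :> 'D_(4.*2).
    by case: m => // m _ u2; rewrite expnS expgM u2 expg1n.
  rewrite !pow2 // z2 Vxy Vx Vy -expgM xy4 eqxx /=.
  by move/commgP: cx => ->; move/commgP: cy => ->.
apply/negP=> abD.
have ab8 : abelian 'D_(4.*2).
  by have /homgP[f <-] := hom8; apply: morphim_abelian.
have /existsP[[x y] /=] := isoGrp_hom (Grp'_dihedral (q := 4) isT).
rewrite !xpair_eqE => /and4P[/eqP defG /eqP x2 /eqP y2 /eqP xy4].
have cxy : commute x y by apply: (centsP ab8); rewrite inE.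
(* Two commuting involutions generate at most 4 elements, not 8. *)
have := card_joing_cycles cxy x2 y2 isT isT.
by rewrite defG card_dihedral.
Qed.

End MinNonAbelian.

(** * Structure of [D]: centre, Frattini subgroup, involutions, automorphisms *)

Section TwoGenerators.

Variables (gT : finGroupType) (r s : nat) (D : {group gT}) (x y : gT).
Hypothesis defD : <[x]> <*> <[y]> = D.
Hypothesis xr : x ^+ (2 ^ r) = 1.
Hypothesis ys : y ^+ (2 ^ s) = 1.
Hypothesis derZ : D^`(1) \subset 'Z(D).
Hypothesis der2 : {in D^`(1), forall z, z ^+ 2 = 1}.
Hypothesis leD : 2 ^ (r + s) <= #|D / D^`(1)|.
Hypothesis nabD : ~~ abelian D.

Lemma gen_x : x \in D. Proof. by rewrite -cycle_subG -defD joing_subl. Qed.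
Lemma gen_y : y \in D. Proof. by rewrite -cycle_subG -defD joing_subr. Qed.

(** As [[~ u, v]] is central, [[~ u ^+ 2, v]] is its square, which is 1. *)
Lemma sqZ : {in D, forall u, u ^+ 2 \in 'Z(D)}.
Proof.
move=> u Du; apply/centerP; split; first exact: groupX.
move=> v Dv; apply/commgP.
have D'uv : [~ u, v] \in D^`(1) by apply: mem_commg.
have /centerP[_ cuv] := subsetP derZ _ D'uv.
by rewrite commXg ?der2 //; apply/commute_sym/cuv.
Qed.

Lemma quo_gens (N : {group gT}) : D \subset 'N(N) ->
  D / N = <[coset N x]> <*> <[coset N y]>.
Proof.
move=> nND; have [Nx Ny] := (subsetP nND _ gen_x, subsetP nND _ gen_y).
by rewrite -defD quotientY ?cycle_subG // !quotient_cycle.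
Qed.

Lemma quo_der : D / D^`(1) = <[coset D^`(1) x]> * <[coset D^`(1) y]>.
Proof.
rewrite quo_gens ?der_norm // cent_joinEr //.
apply: (centSS _ _ (der_abelian 0 D)); rewrite cycle_subG mem_quotient //;
  [exact: gen_y | exact: gen_x].
Qed.

Lemma pgroupD : 2.-group D.
Proof.
have p2 (u : gT) m : u \in D -> u ^+ (2 ^ m) = 1 -> 2.-group <[coset D^`(1) u]>.
  move=> Du um; rewrite /pgroup -orderE (@pnat_dvd _ (2 ^ m)) ?pnatX ?orbT //.
  by rewrite order_dvdn -morphX ?um ?morph1 // (subsetP (der_norm _ _)).
rewrite -(pquotient_pgroup (K := D^`(1)%G)) ?der_norm //.
  by rewrite quo_der pgroupM (p2 _ r) ?gen_x ?(p2 _ s) ?gen_y.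
apply/pgroupP=> q pr_q /(Cauchy pr_q)[z /der2 z2 oz].
rewrite inE /= -(dvdn_prime2 pr_q) // -oz order_dvdn; exact/eqP.
Qed.

(** D/N is generated by two commuting elements of order at most 2, so has at most 4 elements. With
    fewer it would be cyclic, forcing [D] to be abelian as [N] is central. This serves both ['Z(D)]
    and ['Phi(D)]. *)
Lemma index_central (N : {group gT}) :
    D^`(1) \subset N -> N \subset 'Z(D) -> {in D, forall u, u ^+ 2 \in N} ->
  #|D : N| = 4.
Proof.
move=> sD'N sNZ sqN.
have sND : N \subset D := subset_trans sNZ (center_sub D).
have nND : D \subset 'N(N).
  by rewrite cents_norm // centsC (subset_trans sNZ) ?subsetIr.
have coset2 u : u \in D -> coset N u ^+ 2 = 1.
  move=> Du; have Nu := subsetP nND u Du.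
  by rewrite -morphX //= coset_id ?sqN.
have le4 : #|D : N| <= 4.
  rewrite -card_quotient // quo_gens //.
  apply: (@card_joing_cycles _ _ _ 2 2); rewrite ?coset2 ?gen_x ?gen_y //.
  have abQ : abelian (D / N) by rewrite sub_der1_abelian.
  by apply: (centsP abQ); rewrite mem_quotient ?gen_x ?gen_y.
have ncyc : ~~ cyclic (D / N).
  by apply: contra nabD; apply: cyclic_factor_abelian.
move: le4 ncyc (indexg_gt0 D N); rewrite -card_quotient //.
case oQ: #|D / N| => [|[|[|[|[|n]]]]] // _ /negP[].
- by rewrite (card1_trivg oQ) cyclic1.
- by rewrite prime_cyclic // oQ.
- by rewrite prime_cyclic // oQ.
Qed.

Lemma sq_Phi : {in D, forall u, u ^+ 2 \in 'Phi(D)}.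
Proof.
move=> u Du; rewrite (Phi_joing pgroupD); apply: (subsetP (joing_subr _ _)).
by apply: (Mho_p_elt 1 Du); apply: mem_p_elt pgroupD Du.
Qed.

Lemma der_Phi : D^`(1) \subset 'Phi(D).
Proof. by rewrite (Phi_joing pgroupD) joing_subl. Qed.

Lemma Phi_min_sq (N : {group gT}) :
    N \subset D -> D^`(1) \subset N -> {in D, forall u, u ^+ 2 \in N} ->
  'Phi(D) \subset N.
Proof.
move=> sND sD'N sqN; have nND := sub_der1_norm sD'N sND.
apply: (Phi_min pgroupD) => //; apply/abelemP => //; split.
  by rewrite sub_der1_abelian.
by move=> _ /morphimP[u Nu Du ->]; rewrite -morphX //= coset_id ?sqN.
Qed.

Lemma PhiZ : 'Phi(D) \subset 'Z(D).
Proof. by apply: Phi_min_sq; rewrite ?center_sub //; apply: sqZ. Qed.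

Lemma index_Z : #|D : 'Z(D)| = 4.
Proof. exact: index_central derZ (subxx _) sqZ. Qed.

Lemma index_Phi : #|D : 'Phi(D)| = 4.
Proof. exact: index_central der_Phi PhiZ sq_Phi. Qed.

Lemma coset_exp u n : u \in D -> coset D^`(1) (u ^+ n) = coset D^`(1) u ^+ n.
Proof. by move=> Du; rewrite morphX // (subsetP (der_norm 1 D)). Qed.

(** The relations bound the orders of the two cosets from above, while their product is at least the
    order of the quotient, itself at least 2^(r+s). Equality holds throughout, leaving a trivial
    intersection. *)
Lemma quo_der_direct :
  [/\ #[coset D^`(1) x] = (2 ^ r)%N, #[coset D^`(1) y] = (2 ^ s)%N
    & <[coset D^`(1) x]> :&: <[coset D^`(1) y]> = 1].
Proof.
set X := coset _ x; set Y := coset _ y.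
have leX : #[X] <= 2 ^ r.
  by rewrite dvdn_leq ?expn_gt0 // order_dvdn -coset_exp ?gen_x // xr morph1.
have leY : #[Y] <= 2 ^ s.
  by rewrite dvdn_leq ?expn_gt0 // order_dvdn -coset_exp ?gen_y // ys morph1.
have := mul_cardG <[X]> <[Y]>; rewrite -quo_der -!orderE => oXY.
have ltXY a b c d : a < c -> b <= d -> 0 < d -> a * b < c * d.
  move=> ac bd d0; apply: leq_ltn_trans (_ : a * d < _).
    by rewrite leq_mul2l bd orbT.
  by rewrite ltn_pmul2r.
have I_gt0 := cardG_gt0 (<[X]> :&: <[Y]>).
have leI : 2 ^ r * 2 ^ s <= #[X] * #[Y].
  by rewrite oXY -expnD; apply: leq_trans leD _; rewrite leq_pmulr.
have oX : #[X] = (2 ^ r)%N.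
  apply/eqP; rewrite eqn_leq leX leqNgt; apply: contraL leI => ltX.
  by rewrite -ltnNge ltXY ?expn_gt0.
have oY : #[Y] = (2 ^ s)%N.
  apply/eqP; rewrite eqn_leq leY leqNgt; apply: contraL leI => ltY.
  by rewrite -ltnNge mulnC [ltnRHS]mulnC ltXY ?expn_gt0.
split=> //; apply: card1_trivg; apply/eqP; rewrite eqn_leq I_gt0 andbT.
have A_gt0 := cardG_gt0 (D / D^`(1)).
by rewrite -(leq_pmul2l A_gt0) muln1 -oXY oX oY -expnD.
Qed.

Lemma invol_central :
  1 < r -> 1 < s -> {in D, forall u, u ^+ 2 = 1 -> u \in 'Z(D)}.
Proof.
move=> r_gt1 s_gt1 u Du u2; have [oX oY tiXY] := quo_der_direct.
have [Dx Dy] := (gen_x, gen_y).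
have : coset D^`(1) u \in D / D^`(1) by rewrite mem_quotient.
rewrite quo_der => /mulsgP[_ _ /cycleP[i ->] /cycleP[j ->] uXY].
set X := coset _ x in oX tiXY uXY; set Y := coset _ y in oY tiXY uXY.
have cXY : commute X Y.
  by apply: (centsP (der_abelian 0 D)); rewrite mem_quotient.
have XY2 : X ^+ (i * 2) * Y ^+ (j * 2) = 1.
  rewrite !expgM -expgMn; last exact: commuteX2.
  by rewrite -uXY -coset_exp // u2 morph1.
have Xi : X ^+ (i * 2) = 1.
  apply/set1gP; rewrite -tiXY inE mem_cycle /=.
  have -> : X ^+ (i * 2) = (Y ^+ (j * 2))^-1.
    by apply/eqP; rewrite eq_mulgV1 invgK XY2.
  by rewrite groupV mem_cycle.
have Yj : Y ^+ (j * 2) = 1 by rewrite Xi mul1g in XY2.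
(* Cancelling one factor 2 leaves a divisor 2^(n-1) of [m], which is even because n > 1. *)
have even_exp n m : 1 < n -> 2 ^ n %| m * 2 -> exists k, m = (2 * k)%N.
  case: n => [|[|n]] // _; rewrite expnS mulnC dvdn_pmul2r // => /(dvdn_trans _) d.
  have /dvdnP[k ->] : 2 %| m by apply: d; rewrite expnS dvdn_mulr.
  by exists k; rewrite mulnC.
have [k ik] : exists k, i = (2 * k)%N.
  by apply: even_exp r_gt1 _; rewrite -oX order_dvdn Xi.
have [l jl] : exists k, j = (2 * k)%N.
  by apply: even_exp s_gt1 _; rewrite -oY order_dvdn Yj.
have Zxy : x ^+ i * y ^+ j \in 'Z(D).
  by rewrite ik jl !expgM groupM // groupX // sqZ.
have : u * (x ^+ i * y ^+ j)^-1 \in D^`(1).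
  have Dxy : x ^+ i * y ^+ j \in D by rewrite groupM ?groupX.
  have nD := subsetP (der_norm 1 D).
  apply: coset_idr; first by rewrite nD ?groupM ?groupV.
  rewrite morphM ?morphV ?groupV ?nD //= uXY; apply/eqP; rewrite -eq_mulgV1 eq_sym.
  by rewrite morphM ?nD ?groupX //= !coset_exp.
by move/(subsetP derZ); rewrite groupMr ?groupV.
Qed.

Lemma aut_pgroup : s < r -> 2.-group (Aut D).
Proof.
move=> lt_sr; have [oX oY tiXY] := quo_der_direct.
have [Dx Dy] := (gen_x, gen_y).
pose M := (coset D^`(1) @*^-1 'Ohm_r.-1(D / D^`(1)))%G.
have sM : M \subset D.
  by rewrite sub_cosetpre_quo ?der_normal // Ohm_sub.
have pQ : 2.-group (D / D^`(1)) by rewrite quotient_pgroup ?pgroupD.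
have OhmE : 'Ohm_r.-1(D / D^`(1)) = 'Ldiv_(2 ^ r.-1)(D / D^`(1)).
  apply: OhmEabelian => //; exact: abelianS (Ohm_sub _ _) (der_abelian 0 D).
have inM u : u \in D -> (u \in M) = (coset D^`(1) u ^+ (2 ^ r.-1) == 1).
  move=> Du; rewrite /= in_setI (subsetP (der_norm 1 D)) //= inE OhmE.
  by rewrite in_setI mem_quotient // inE.
have charM : M \char D.
  apply: (@char_from_quotient _ D D^`(1) M).
  - rewrite /normal sub_cosetpre (subset_trans sM) ?der_norm //.
  - exact: der_char.
  by rewrite cosetpreK Ohm_char.
have r_gt0 : 0 < r by apply: leq_ltn_trans lt_sr.
have M'x : x \notin M.
  by rewrite inM // -order_dvdn oX dvdn_Pexp2l // -ltnNge prednK.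
have My : y \in M.
  by rewrite inM // -order_dvdn oY dvdn_Pexp2l // -ltnS prednK.
(* Otherwise [y] would be central and [D] abelian. *)
have P'y : y \notin 'Phi(D).
  apply: contra nabD => /(subsetP PhiZ)/centerP[_ cy].
  rewrite -defD abelianY !cycle_abelian /= cycle_subG.
  by apply/centP=> _ /cycleP[i ->]; apply/commuteX/cy.
apply: (@Aut_2group _ D M); rewrite ?pgroupD ?index_Phi //.
- rewrite properE; apply/andP; split; last by apply/subsetPn; exists y.
  apply: Phi_min_sq => //; first exact: sub_cosetpre.
  move=> u Du; rewrite inM ?groupX // coset_exp // -expgM -expnS prednK //.
  have : coset D^`(1) u \in D / D^`(1) by rewrite mem_quotient.
  rewrite quo_der => /mulsgP[_ _ /cycleP[i ->] /cycleP[j ->] ->].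
  rewrite expgMn; last first.
    by apply: commuteX2; apply: (centsP (der_abelian 0 D)); rewrite mem_quotient.
  rewrite -!expgM ![(_ * 2 ^ r)%N]mulnC !expgM -!coset_exp ?groupX // xr.
  by rewrite -(subnKC (ltnW lt_sr)) expnD expgM ys !(morph1, expg1n) mulg1.
by rewrite properE sM; apply/subsetPn; exists x.
Qed.

End TwoGenerators.

Theorem theorem2p4 (gT : finGroupType) (r s : nat) (D : {group gT})
    (F : fusion_system D) :
  (1 <= s)%N -> (s <= r)%N ->
  D \isog Grp (x : y : x ^+ (2 ^ r)%N, y ^+ (2 ^ s)%N, [x, y] ^+ 2,
                       [x, [x, y]], [y, [x, y]]) ->
  saturated F 2 ->
  [\/ fusion_nilpotent F, s = 1%N | r = s] /\
  (r = s -> (2 <= r)%N -> fusion_controlled F).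
Proof.
move=> s_gt0 le_sr presD satF; have r_gt0 := leq_trans s_gt0 le_sr.
have [x [y [defD xr ys derZ der2]]] := pres_gens presD.
have leD := card_der1_quotient r_gt0 s_gt0 presD.
have nabD := pres_nonabelian r_gt0 s_gt0 presD.
have comm2 : {in D &, forall u v, [~ u, v] ^+ 2 = 1}.
  by move=> u v Du Dv; apply/der2/mem_commg.
have iZ := index_Z defD derZ der2 nabD.
(* Control holds whenever s > 1, since then r > 1 too; both conclusions rest on it. *)
have extF : 1 < s -> forall P f, F P D f ->
    exists2 a, a \in AutF F D & {in P, f =1 a}.
- move=> s_gt1 P f; apply: extends_to_AutF => //.
  exact: (invol_central defD xr ys derZ der2 leD (leq_trans s_gt1 le_sr) s_gt1).
split=> [|eq_rs r_gt1 P Q f Ff]; last first.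
  have s_gt1 : 1 < s by rewrite -eq_rs.
  exact: (extF s_gt1 P f (fhom_subr (fhom_sub Ff).2 (subxx D) Ff)).
move: s_gt0; rewrite leq_eqVlt => /predU1P[<- | s_gt1]; first by constructor 2.
move: le_sr; rewrite leq_eqVlt => /predU1P[-> | lt_sr]; first by constructor 3.
constructor 1; apply: fusion_nilpotent_pAut satF _ (extF s_gt1).
have sAut : Group (AutF_group_set F (subxx D)) \subset Aut D.
  by apply/subsetP=> a /setIdP[].
exact: pgroupS sAut (aut_pgroup defD xr ys derZ der2 leD nabD lt_sr).
Qed.
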